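(* Let $N\geq2$ and $n_1,\dots,n_N\geq1$ be integers, $L=\sum_{i=1}^N n_i$, and $I=\{(i,j):1\le i\le N,\ 1\le j\le n_i\}$. For each $i\in\{1,\dots,N\}$ let $\mathbf{E}_i\subset(0,1)^L$ be a set with $\dim_H\mathbf{E}_i\le L-1$ such that for every $\underline\lambda\in(0,1)^L\setminus\mathbf{E}_i$ the two-fixed-point IFS $\mathcal{S}_i$ (defined in the context) satisfies ESC for CFS (such sets exist), and let $\mathbf{E}=\bigcup_{i=1}^N\mathbf{E}_i$. Then for every $\underline{\lambda}\in(0,1)^L\setminus\mathbf{E}$ there exists $\mathbf{F}\subset \mathbb{R}^N$ such that $\dim_{H}\mathbf{F}\leq N-1$ and the IFS $\mathcal{S}_{\underline\lambda,\underline t}$ satisfies ESC for CFS for all parameters $\underline{t}\in \mathbb{R}^N\setminus \mathbf{F}$.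
   Context: For $\underline\lambda=(\lambda_{i,j})_{(i,j)\in I}\in(0,1)^L$ and $\underline t=(t_1,\dots,t_N)\in\mathbb{R}^N$, $\mathcal{S}_{\underline\lambda,\underline t}=\{f_{i,j}(x)=\lambda_{i,j}x+t_i(1-\lambda_{i,j}):(i,j)\in I\}$. For $i\in\{1,\dots,N\}$, $\mathcal{S}_i$ is the IFS indexed by the same alphabet $I$ in which the symbol $(i,j)$ corresponds to the map $x\mapsto\lambda_{i,j}x+(1-\lambda_{i,j})$ and the symbol $(k,j)$ with $k\ne i$ corresponds to $x\mapsto\lambda_{k,j}x$; its maps have only the fixed points $1$ and $0$. Words: $\Sigma_n=I^n$. For a word $\mathbf{i}=a_1\cdots a_n$ let $\lambda_{\mathbf{i}}=\lambda_{a_1}\cdots\lambda_{a_n}$ and $\Pi(\mathbf{i})=f_{a_1}\circ\cdots\circ f_{a_n}(0)$, where $f_a$ are the maps of the IFS under consideration. Blocks: the alphabet is divided into groups of symbols sharing the same fixed point (for $\mathcal{S}_{\underline\lambda,\underline t}$ the groups are $\{(i,1),\dots,(i,n_i)\}$, $1\le i\le N$; for $\mathcal{S}_i$ the two groups are $\{(i,j)\}_j$ and $\{(k,j):k\neq i\}$). Each word decomposes uniquely into blocks, i.e. maximal runs of consecutive symbols from the same group. Two words have the same block structure if they have the same number of blocks and, for every $l$, their $l$-th blocks come from the same group and contain each symbol of $I$ the same number of times. An IFS indexed by the alphabet $I$, namely $\mathcal{S}_{\underline\lambda,\underline t}$ or one of $\mathcal{S}_1,\dots,\mathcal{S}_N$,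 satisfies the Exponential Separation Condition for Common Fixed Point Systems (ESC for CFS) if there exist $n_0\in\mathbb{N}$ and $b>1$ such that for every $n\ge n_0$ and all $\mathbf{i},\mathbf{j}\in\Sigma_n$ with $\lambda_{\mathbf{i}}=\lambda_{\mathbf{j}}$, either $\mathbf{i},\mathbf{j}$ have the same block structure (with respect to that IFS) or $|\Pi(\mathbf{i})-\Pi(\mathbf{j})|>2^{-bn}$. $\dim_H$ is the Hausdorff dimension. *)

(* Defs.v *)
From HB Require Import structures.
From mathcomp Require Import all_boot all_order all_algebra.
From mathcomp Require Import all_classical all_reals all_analysis.
Import Order.TTheory GRing.Theory Num.Theory.

Set Implicit Arguments.
Unset Strict Implicit.
Unset Printing Implicit Defensive.

Local Open Scope classical_set_scope.
Local Open Scope ring_scope.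

Section Hausdorff.
Context {R : realType} {T : Type}.
Variable d : T -> T -> R.

(* diameter set0 = -oo; the empty set is treated apart in hweight *)
Definition diameter (U : set T) : \bar R :=
  ereal_sup [set (d x y)%:E | x in U & y in U].

(* diam(U)^s with the conventions 0^0 = 1 and diam(set0)^s = 0 for all s *)
Definition hweight (s : R) (U : set T) : \bar R :=
  if U == set0 then 0%E else poweR (diameter U) s.

Definition hausdorff_pre (s delta : R) (A : set T) : \bar R :=
  ereal_inf [set (\sum_(0 <= k <oo) hweight s (U k))%E | U in
    [set U : nat -> set T | A `<=` \bigcup_k U k /\
                            forall k, (diameter (U k) <= delta%:E)%E]].

Definition hausdorff_measure (s : R) (A : set T) : \bar R :=
  ereal_sup [set hausdorff_pre s delta A | delta in [set delta | 0 < delta]].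

Definition hausdorff_dim (A : set T) : \bar R :=
  ereal_inf [set s%:E | s in [set s | 0 <= s /\ hausdorff_measure s A = 0%E]].

End Hausdorff.

(* R^J, for a finite index type J, is {ffun J -> R} *)
Definition euclidean_dist {R : realType} {J : finType} (x y : {ffun J -> R}) : R :=
  Num.sqrt (\sum_j (x j - y j) ^+ 2).

Definition dimH {R : realType} {J : finType} (A : set {ffun J -> R}) : \bar R :=
  hausdorff_dim euclidean_dist A.

Definition open_unit_cube {R : realType} {J : finType} : set {ffun J -> R} :=
  [set x | forall j, 0 < x j < 1].

Section Words.
Context {R : realType} {I : finType} {G : eqType}.
(* grp a names the group (of maps with a common fixed point) the symbol a is in *)
Variables (grp : I -> G) (lam : I -> R) (f : I -> R -> R).

Definition word_ratio (w : seq I) : R := \prod_(a <- w) lam a.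

Definition word_point (w : seq I) : R := foldr f 0 w.

(* the maximal runs of consecutive symbols of w from the same group *)
Fixpoint blocks (w : seq I) : seq (seq I) :=
  if w is a :: w' then
    match blocks w' with
    | (b :: B) :: Bs =>
        if grp a == grp b then (a :: b :: B) :: Bs
        else [:: a] :: (b :: B) :: Bs
    | _ => [:: [:: a]]
    end
  else [::].

Definition same_block_structure (v w : seq I) : Prop :=
  size (blocks v) = size (blocks w) /\
  forall l, (l < size (blocks v))%N ->
    let B := nth [::] (blocks v) l in
    let C := nth [::] (blocks w) l in
    (forall a b, a \in B -> b \in C -> grp a = grp b) /\
    (forall a, count_mem a B = count_mem a C).

Definition ESC_CFS : Prop :=
  exists (n0 : nat) (b : R), 1 < b /\
    forall n, (n0 <= n)%N -> forall v w : n.-tuple I,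
      word_ratio v = word_ratio w ->
      same_block_structure v w \/
      2 `^ (- (b * n%:R)) < `|word_point v - word_point w|.

End Words.

Section Systems.
Context {R : realType} {N : nat}.
Variable n : 'I_N -> nat.

Definition alphabet : finType := {i : 'I_N & 'I_(n i)}.

Definition cfs_map (lam : {ffun alphabet -> R}) (t : {ffun 'I_N -> R})
    (a : alphabet) (x : R) : R :=
  lam a * x + t (tag a) * (1 - lam a).

Definition cfs_ESC (lam : {ffun alphabet -> R}) (t : {ffun 'I_N -> R}) : Prop :=
  ESC_CFS (fun a : alphabet => tag a) lam (cfs_map lam t).

Definition two_point_map (i : 'I_N) (lam : {ffun alphabet -> R})
    (a : alphabet) (x : R) : R :=
  if tag a == i then lam a * x + (1 - lam a) else lam a * x.

Definition two_point_ESC (i : 'I_N) (lam : {ffun alphabet -> R}) : Prop :=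
  ESC_CFS (fun a : alphabet => tag a == i) lam (two_point_map i lam).

End Systems.

(* Main.v *)
(* For fixed lambda the point Pi_t(w) of a word is linear in t, and its i-th
   coefficient is the point of w in the two-fixed-point system S_i. If two words
   have different block structures, then so they do with respect to some S_i,
   whose separation bounds one coefficient of the difference Pi_t(v) - Pi_t(w)
   below by 2^(-Bn). A parameter t violating the separation condition therefore
   lies, for every D, in infinitely many of the slabs
   {t : |Pi_t(v) - Pi_t(w)| <= 2^(-(B+D)n)}, of width at most about 2^(-Dn). At
   level n there are at most L^(2n) slabs, and each of them meets the cube
   [-2^n, 2^n]^N in a set covered by O(2^((D+1)n(N-1))) sets of diameter
   O(2^(-Dn)). For s > N-1 and D large the resulting weights are summable, so the
   exceptional set is null for the s-dimensional Hausdorff measure. *)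
Require Import Defs.
From HB Require Import structures.
From mathcomp Require Import all_boot all_order all_algebra.
From mathcomp Require Import all_classical all_reals all_analysis.
From mathcomp Require Import ring lra.
Import Order.TTheory GRing.Theory Num.Theory.
Import numFieldNormedType.Exports.
Local Open Scope classical_set_scope.
Local Open Scope ring_scope.

Set Implicit Arguments.
Unset Strict Implicit.

(** * Block structures through prefixes at group changes *)

Section BlockStructure.
Local Open Scope nat_scope.
Context {I : finType} {G : eqType}.
Implicit Types (g : I -> G) (u v w : seq I).

(* [None] past the end, so that the end of a word counts as a change of group. *)
Definition group_at g v (p : nat) : option G := nth None [seq Some (g a) | a <- v] p.

(** Unlike lists of blocks, prefixes can be compared between different groupings of the same words.
    The condition is vacuous at [p = 0], where [p.-1 = p]; at the end of a nonempty word it concerns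
    the whole words. *)
Definition balanced_prefixes g v w : Prop :=
  [seq g a | a <- v] = [seq g a | a <- w] /\
  forall p, group_at g v p.-1 <> group_at g v p -> perm_eq (take p v) (take p w).

Lemma group_at_cat g u v p :
  group_at g (u ++ v) p =
  if p < size u then group_at g u p else group_at g v (p - size u).
Proof. by rewrite /group_at map_cat nth_cat size_map. Qed.

Lemma group_at_const g u x p :
  {in u, forall a, g a = x} -> p < size u -> group_at g u p = Some x.
Proof.
elim: u p => [|a u IH] // [|p] ux pu.
  by rewrite /group_at /= ux ?mem_head.
by apply: IH => // b bu; apply: ux; rewrite inE bu orbT.
Qed.

Definition run_size g (a : I) u : nat := find (fun x => x != g a) [seq g b | b <- u].

Lemma blocks_cons g a u :
  blocks g (a :: u) =
  (a :: take (run_size g a u) u) :: blocks g (drop (run_size g a u) u).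
Proof.
rewrite /run_size; elim: u a => [|b u IH] a; first by [].
have -> : blocks g [:: a, b & u] = match blocks g (b :: u) with
    | (c :: B) :: Bs => if g a == g c then (a :: c :: B) :: Bs
                        else [:: a] :: (c :: B) :: Bs
    | _ => [:: [:: a]] end by [].
rewrite IH /= eq_sym; case: eqP => [ba|/eqP ba] /=.
  by rewrite ba.
by have := IH b; rewrite /= => ->.
Qed.

Lemma run_size_group g a u : {in a :: take (run_size g a u) u, forall b, g b = g a}.
Proof.
move=> b; rewrite inE => /orP[/eqP->//|].
rewrite /run_size; elim: u => //= c u IH.
by case: eqP => //= ca; rewrite inE => /orP[/eqP-> //|/IH].
Qed.

Lemma size_run g a u : size (take (run_size g a u) u) = run_size g a u.
Proof. by rewrite size_takel // -(size_map g u) find_size. Qed.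

Lemma group_at_run_end g a u : group_at g (drop (run_size g a u) u) 0 <> Some (g a).
Proof.
rewrite /run_size; elim: u => //= b u IH.
by case: eqP => //= ba [].
Qed.

Lemma flatten_blocks g v : flatten (blocks g v) = v.
Proof.
have [n] := ubnP (size v); elim: n v => // n IH [|a u] //= un.
rewrite -/(blocks g (a :: u)) blocks_cons /= IH ?cat_take_drop //.
by rewrite size_drop (leq_ltn_trans (leq_subr _ _)).
Qed.

Lemma count_mem_perm (u v : seq I) :
  (forall a, count_mem a u = count_mem a v) <-> perm_eq u v.
Proof.
split=> [uv|/permP uv a]; last exact: uv.
by apply/allP => a _; rewrite /= uv.
Qed.

(** Induction on the list of blocks: no group change occurs strictly inside the first block; at its
    end the prefixes are the two first blocks; past it, the induction applies to what follows
    them. *)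
Lemma flatten_balanced g (Bs Cs : seq (seq I)) :
  size Bs = size Cs ->
  (forall l, l < size Bs ->
    (forall a b, a \in nth [::] Bs l -> b \in nth [::] Cs l -> g a = g b) /\
    (forall a, count_mem a (nth [::] Bs l) = count_mem a (nth [::] Cs l))) ->
  balanced_prefixes g (flatten Bs) (flatten Cs).
Proof.
elim: Bs Cs => [|B Bs IH] [|C Cs] //.
move=> [] sz blk.
have [eqg pre] := IH _ sz (fun l => blk l.+1).
have {blk} /= [gBC /count_mem_perm BC] := blk 0 isT.
have szBC := perm_size BC.
(* An empty block has no group; [None] then serves vacuously. *)
have [x Bx Cx] : exists2 x : option G, {in B, forall a, Some (g a) = x}
    & {in C, forall a, Some (g a) = x}.
  have inC a : a \in B -> a \in C by rewrite (perm_mem BC).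
  case: B C gBC BC inC {szBC} => [|b B] C gBC BC inC.
    by exists None => // a; rewrite -(perm_mem BC).
  exists (Some (g b)) => a.
    by move=> /inC aC; rewrite (gBC b a) ?mem_head.
  by move=> aC; rewrite (gBC b a) ?mem_head.
have eqBC : [seq g a | a <- B] = [seq g a | a <- C].
  move: Bx Cx szBC {gBC BC}; elim: B C => [|b B IHB] [|c C] //= Bx Cx [] szBC.
  congr cons.
    by have := Bx _ (mem_head _ _); rewrite -(Cx _ (mem_head _ _)) => -[].
  by apply: IHB => // a aBC; [apply: Bx|apply: Cx]; rewrite inE aBC orbT.
split=> [|p]; first by rewrite /= !map_cat eqBC eqg.
rewrite !group_at_cat !take_cat -szBC.
have [pB|Bp] := ltnP p (size B); last first.
  have [->|] := eqVneq p (size B).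
    by rewrite subnn !take0 !cats0.
  move=> neq; have {neq}Bp : size B < p by rewrite ltn_neqAle eq_sym neq.
  have -> : p.-1 < size B = false by case: p Bp => //= p; rewrite ltnS ltnNge => ->.
  move=> bd; rewrite perm_cat //; apply: pre.
  by rewrite -subn1 subnAC subn1 in bd.
rewrite (leq_ltn_trans (leq_pred _) pB).
case: B pB Bx {Cx gBC BC szBC eqBC} => // b B pB Bx.
have gc : {in b :: B, forall a, g a = g b}.
  by move=> a aB; have := Bx _ aB; rewrite -(Bx _ (mem_head _ _)) => -[].
by rewrite !(group_at_const gc) ?(leq_ltn_trans (leq_pred _) pB).
Qed.

Lemma same_block_structure_balanced g v w :
  same_block_structure g v w -> balanced_prefixes g v w.
Proof.
case=> sz blk; rewrite -(flatten_blocks g v) -(flatten_blocks g w).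
exact: flatten_balanced.
Qed.

(** Equal group sequences give first runs of equal length, and a run ends at a group change, so the
    first blocks are permutations of each other. They cancel from longer prefixes, which passes the
    hypothesis on to the remaining words. *)
Lemma balanced_same_block_structure g v w :
  balanced_prefixes g v w -> same_block_structure g v w.
Proof.
have [n] := ubnP (size v).
elim: n v w => // n IH [|a u] [|b z] //= un [] //= [gab guz] pre.
have run : run_size g b z = run_size g a u by rewrite /run_size guz gab.
rewrite /same_block_structure !blocks_cons run.
set k := run_size g a u.
have kE : size (a :: take k u) = k.+1 by rewrite /= size_run.
have Ek (p : nat) : group_at g (a :: u) (k.+1 + p) = group_at g (drop k u) p.
  rewrite -{1}(cat_take_drop k u) -cat_cons group_at_cat kE.
  by rewrite ltnNge leq_addr /= addKn.
have cut : perm_eq (a :: take k u) (b :: take k z).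
  have : perm_eq (take k.+1 (a :: u)) (take k.+1 (b :: z)).
    apply: pre; rewrite -[X in _ <> group_at _ _ X]addn0 Ek /= => /esym.
    rewrite -(cat_take_drop k u) -cat_cons group_at_cat kE leqnn.
    rewrite cat_take_drop (group_at_const (@run_size_group g a u)) ?kE //.
    exact: group_at_run_end.
  by [].
have [] := IH (drop k u) (drop k z).
- by rewrite size_drop (leq_ltn_trans (leq_subr _ _)).
- split; first by rewrite !map_drop guz.
  case=> [|p] bd; first by rewrite !take0.
  have /pre : group_at g (a :: u) (k.+1 + p.+1).-1 <> group_at g (a :: u) (k.+1 + p.+1).
    by rewrite Ek addnS -[_.+1.-1]/(k.+1 + p) Ek.
  rewrite addSn /= !takeD -!cat_cons => pe.
  rewrite -(perm_cat2l (a :: take k u)); apply: perm_trans pe _.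
  by rewrite perm_cat2r perm_sym.
move=> sz blk; split=> [|[|l] lB] /=; first by rewrite sz.
  split; last exact: (proj2 (count_mem_perm _ _) cut).
  move=> c d /run_size_group -> ; rewrite /k -run => /run_size_group ->.
  exact: gab.
exact: blk.
Qed.

End BlockStructure.

Lemma group_at_comp (I : finType) (G H : eqType) (g : I -> G) (h : G -> H) v p :
  group_at (fun a => h (g a)) v p = omap h (group_at g v p).
Proof. by rewrite /group_at; elim: v p => [|a v IH] [|p] //=; apply: IH. Qed.

(** A passage from group [x] to group [y] is still visible in the partition into [x] and its
    complement, so this partition alone yields the permutation of prefixes at that place. *)
Lemma same_block_structure_two_groups (I : finType) (G : eqType) (g : I -> G)
    (v w : seq I) :
  size v = size w ->
  (forall i, same_block_structure (fun a => g a == i) v w) ->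
  same_block_structure g v w.
Proof.
move=> sz two; apply: balanced_same_block_structure.
have {}two i := same_block_structure_balanced (two i).
split=> [|p bd].
  have {}two i : [seq g a == i | a <- v] = [seq g a == i | a <- w].
    by have [] := two i.
  elim: v w sz two => [|a v IH] [|b w] //= [] sz two.
  congr cons; first by have [] := two (g a); rewrite eqxx => /esym/eqP ->.
  by apply: IH => // i; have [] := two i.
have [i bdi] : exists i, omap (eq_op^~ i) (group_at g v p.-1) <>
                         omap (eq_op^~ i) (group_at g v p).
  case: (group_at g v p.-1) (group_at g v p) bd => [x|] [y|] // bd.
  - exists x => /= -[]; rewrite eqxx => /esym/eqP yx; apply: bd.
    by rewrite yx.
  - by exists x.
  - by exists y.
by have [_] := two i; apply; rewrite !(group_at_comp g (fun j => j == i)).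
Qed.

(** * Hausdorff measure of limsup sets *)

Section HausdorffMeasureLimsup.
Context {R : realType} {T : Type} (d : T -> T -> R).
Implicit Types (s r : R) (U A : set T).

Lemma hweight_ge0 s U : (0 <= hweight d s U)%E.
Proof. by rewrite /hweight; case: ifP => // _; exact: poweR_ge0. Qed.

Lemma diameter_le r U : (forall x y, U x -> U y -> d x y <= r) ->
  (diameter d U <= r%:E)%E.
Proof.
by move=> dU; apply: ge_ereal_sup => _ [x Ux [y Uy <-]]; rewrite lee_fin dU.
Qed.

Lemma hweight_le s r U : (forall x y, 0 <= d x y) -> 0 <= s -> 0 <= r ->
  (forall x y, U x -> U y -> d x y <= r) -> (hweight d s U <= (r `^ s)%:E)%E.
Proof.
move=> d0 s0 r0 dU; rewrite /hweight; case: eqVneq => [_|/set0P[x Ux]].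
  by rewrite lee_fin powR_ge0.
have diam0 : (0 <= diameter d U)%E.
  apply: (@le_trans _ _ (d x x)%:E); first by rewrite lee_fin.
  by apply: ereal_sup_ubound; exists x => //; exists x.
rewrite -poweR_EFin; apply: gt0_ler_poweR => //; last exact: diameter_le.
- by rewrite in_itv/= diam0 leey.
- by rewrite in_itv/= lee_fin r0 leey.
Qed.

Lemma hausdorff_pre_ge0 s delta A : (0 <= hausdorff_pre d s delta A)%E.
Proof.
apply: le_ereal_inf_tmp => _ [U _ <-].
by apply: nneseries_ge0 => n _ _; exact: hweight_ge0.
Qed.

Lemma hausdorff_pre_le2 s delta A (U : nat -> nat -> set T) :
  A `<=` \bigcup_n \bigcup_i U n i ->
  (forall n i, (diameter d (U n i) <= delta%:E)%E) ->
  (hausdorff_pre d s delta A <=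
   \sum_(0 <= n <oo) \sum_(0 <= i <oo) hweight d s (U n i))%E.
Proof.
move=> AU dU; have /card_set_bijP[e /[dup] ebij [_ _ esurj]] := card_esym card_nat2.
have -> : (\sum_(0 <= n <oo) \sum_(0 <= i <oo) hweight d s (U n i) =
           \sum_(0 <= k <oo) hweight d s (U (e k).1 (e k).2))%E.
  rewrite nneseries_esumT; last first.
    by move=> n; exact: hweight_ge0.
  rewrite nneseries_esumT; last first.
    by move=> n; apply: nneseries_ge0 => *; exact: hweight_ge0.
  rewrite (eq_esum (fun n _ => nneseries_esumT (fun i => hweight_ge0 s (U n i)))).
  rewrite esum_esum; last by move=> *; exact: hweight_ge0.
  rewrite (_ : _ `*`` _ = setT); last by apply/seteqP.
  exact: reindex_esum.
apply: ereal_inf_lbound; exists (fun k => U (e k).1 (e k).2) => //; split => //.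
move=> t /AU[n _ [i _ Ut]]; have [k _ ek] := esurj (n, i) I.
by exists k => //; rewrite ek.
Qed.

(** Borel-Cantelli argument: for every [n0] the levels [n >= n0] cover [A], with total weight at
    most a tail of a convergent series. *)
Lemma hausdorff_measure_limsup s A (C : nat -> seq (set T)) (r : nat -> R) :
  (forall x y, 0 <= d x y) -> 0 <= s -> (forall n, 0 <= r n) ->
  r @ \oo --> (0 : R) ->
  (forall n i x y, nth set0 (C n) i x -> nth set0 (C n) i y -> d x y <= r n) ->
  (\sum_(0 <= n <oo) ((size (C n))%:R * r n `^ s)%:E < +oo)%E ->
  (forall t, A t -> forall n0, exists2 n, (n0 <= n)%N & exists i, nth set0 (C n) i t) ->
  hausdorff_measure d s A = 0%E.
Proof.
move=> d0 s0 r0 rcvg Cd Cfin AC.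
have pre0 delta : 0 < delta -> hausdorff_pre d s delta A = 0%E.
  move=> delta0; apply/eqP; rewrite eq_le hausdorff_pre_ge0 andbT.
  apply/lee_addgt0Pr => eps eps0; rewrite add0e.
  have ge0 n : (0 <= ((size (C n))%:R * r n `^ s)%:E)%E.
    by rewrite lee_fin mulr_ge0 ?powR_ge0.
  have tail := nneseries_tail_cvg Cfin (fun n _ => ge0 n).
  have /fine_cvgP[tfin tcvg] := tail.
  have [n0 _ n0P] : \forall n \near \oo, [/\ r n <= delta,
      (\sum_(n <= k <oo) ((size (C k))%:R * r k `^ s)%:E)%E \is a fin_num &
      fine (\sum_(n <= k <oo) ((size (C k))%:R * r k `^ s)%:E)%E <= eps].
    near=> n; split; near: n.
    - exact: cvgr_le rcvg _ delta0.
    - exact: tfin.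
    - exact: cvgr_le tcvg _ eps0.
  have [_ fin tle] := n0P n0 (leqnn _).
  apply: (le_trans (hausdorff_pre_le2 s (U := fun n i => nth set0 (C (n + n0)%N) i) _ _)).
  - move=> t /AC /(_ n0)[n n0n [i Ct]]; exists (n - n0)%N => //; exists i => //.
    by rewrite subnK.
  - move=> n i; apply: diameter_le => x y Ux Uy; apply: le_trans (Cd _ _ _ _ Ux Uy) _.
    by have [] := n0P (n + n0)%N (leq_addl _ _).
  apply: (@le_trans _ _ (\sum_(n0 <= k <oo) ((size (C k))%:R * r k `^ s)%:E)%E).
    rewrite -(nneseries_addn _ ge0); apply: lee_nneseries => [n _ _|n _].
      by apply: nneseries_ge0 => *; exact: hweight_ge0.
    rewrite (nneseries_split _ (size (C (n + n0)%N))) => [|*]; last exact: hweight_ge0.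
    (* Past the end of the list [nth] returns [set0], whose weight is 0 by convention, even for
       [s = 0]. *)
    rewrite eseries0 ?adde0 => [|i]; last first.
      by rewrite add0n => Ci _; rewrite nth_default // /hweight eqxx.
    apply: (@le_trans _ _ (\sum_(0 <= k < 0 + size (C (n + n0)%N)) (r (n + n0)%N `^ s)%:E)%E).
      by apply: lee_sum => i _; apply: hweight_le => // x y; exact: Cd.
    by rewrite sumEFin lee_fin sumr_const_nat add0n subn0 mulr_natl.
  by rewrite -(fineK fin) lee_fin.
rewrite /hausdorff_measure (_ : [set _ | _ in _] = [set 0%E]) ?ereal_sup1 //.
apply/seteqP; split=> [_ [delta delta0 <-]|_ ->]; first by rewrite pre0.
by exists 1; [exact: ltr01|rewrite pre0 ?ltr01].
Unshelve. all: by end_near. Qed.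

End HausdorffMeasureLimsup.

(** Prepending [a] scales all the points by [lam a], and adds [1 - lam a] only in the system [S_i]
    with [i = tag a]; weighted by [t i], this is the translation part of [cfs_map]. *)
Lemma word_point_cfs (R : realType) (N : nat) (n : 'I_N -> nat)
    (lam : {ffun alphabet n -> R}) (t : {ffun 'I_N -> R}) (w : seq (alphabet n)) :
  word_point (cfs_map lam t) w =
  \sum_i t i * word_point (two_point_map i lam) w.
Proof.
elim: w => [|a w IH] /=; first by rewrite big1 // => i _; rewrite mulr0.
rewrite -/(word_point _ _) {1}/cfs_map IH mulr_sumr.
rewrite -[X in _ + X](big_pred1_eq +%R (tag a) (fun i => t i * (1 - lam a))).
rewrite big_mkcond -big_split /=; apply: eq_bigr => i _.
rewrite {2}/two_point_map eq_sym; case: eqP => _ /=.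
  by rewrite mulrCA -mulrDr.
by rewrite addr0 mulrCA.
Qed.

(** * Covering slabs by small cells *)

Section Slabs.
Context {R : realType}.

Lemma euclidean_dist_ge0 (J : finType) (x y : {ffun J -> R}) : 0 <= euclidean_dist x y.
Proof. exact: sqrtr_ge0. Qed.

Lemma euclidean_dist_le_sum (J : finType) (x y : {ffun J -> R}) :
  euclidean_dist x y <= \sum_j `|x j - y j|.
Proof.
have S0 : 0 <= \sum_j `|x j - y j| by apply: sumr_ge0.
rewrite -[leRHS]ger0_norm // -sqrtr_sqr ler_wsqrtr // [leRHS]expr2 mulr_suml.
apply: ler_sum => j _; rewrite -real_normK ?num_real //.
by rewrite expr2 ler_wpM2l // (bigD1 j) //= lerDl sumr_ge0.
Qed.

(* The coordinate with the largest coefficient is determined, up to the width of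
   the slab, by the remaining ones. *)
Lemma slab_cell_dist (N : nat) (c : 'I_N.+1 -> R) (i0 : 'I_N.+1) (eta delta : R)
    (x y : {ffun 'I_N.+1 -> R}) :
  (forall i, `|c i| <= `|c i0|) -> 0 < `|c i0| -> eta <= `|c i0| * delta ->
  `|\sum_i x i * c i| <= eta -> `|\sum_i y i * c i| <= eta ->
  (forall j, `|x (lift i0 j) - y (lift i0 j)| <= delta) ->
  euclidean_dist x y <= (2 * N + 2)%:R * delta.
Proof.
move=> cmax c0 etad xs ys xy; apply: le_trans (euclidean_dist_le_sum x y) _.
rewrite (bigD1_ord i0) //=.
have others : \sum_(j < N) `|x (lift i0 j) - y (lift i0 j)| <= N%:R * delta.
  apply: le_trans (ler_sum _ (fun j _ => xy j)) _.
  by rewrite sumr_const card_ord mulr_natl.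
(* Solve for coordinate [i0]: the two slab values contribute [2 * eta], the other coordinates at
   most [|c i0| * delta] each. *)
have pinned : `|x i0 - y i0| <= 2 * delta + N%:R * delta.
  rewrite -(ler_pM2l c0) -normrM.
  have -> : c i0 * (x i0 - y i0) = \sum_i x i * c i - \sum_i y i * c i
      - \sum_(j < N) c (lift i0 j) * (x (lift i0 j) - y (lift i0 j)).
    rewrite -sumrB (bigD1_ord i0) //=.
    have -> : \sum_(j < N) (x (lift i0 j) * c (lift i0 j) - y (lift i0 j) * c (lift i0 j)) =
        \sum_(j < N) c (lift i0 j) * (x (lift i0 j) - y (lift i0 j)).
      by apply: eq_bigr => j _; ring.
    by ring.
  apply: le_trans (ler_normB _ _) _; rewrite mulrDr; apply: lerD.
    apply: le_trans (ler_normB _ _) _.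
    by rewrite mulrCA mulr2n mulrDl !mul1r lerD // (le_trans _ etad).
  apply: le_trans (ler_norm_sum _ _ _) _.
  apply: (@le_trans _ _ (\sum_(j < N) `|c i0| * delta)); last first.
    by rewrite sumr_const card_ord -[leLHS]mulr_natl [leLHS]mulrCA.
  by apply: ler_sum => j _; rewrite normrM ler_pM.
apply: le_trans (lerD pinned others) _.
by rewrite natrD natrM; lra.
Qed.

Lemma powR_exprV2 (s : R) (m : nat) : (2 ^- m) `^ s = (2 `^ (- s)) ^+ m :> R.
Proof.
by rewrite -powR_mulrn ?powR_ge0 // -powRrM mulNr mulrC -mulNr powRrM powRN powR_mulrn.
Qed.

Lemma half_open_cell (m : nat) (delta M z : R) : 0 < delta ->
  - M <= z -> z < M -> 2 * M <= m%:R * delta ->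
  exists k : 'I_m, k%:R * delta - M <= z <= k.+1%:R * delta - M.
Proof.
move=> delta0 Mz zM mM.
have z0 : 0 <= (z + M) / delta by apply: divr_ge0; [lra|exact: ltW].
have /andP[lo hi] := truncn_itv z0.
have km : (Num.truncn ((z + M) / delta) < m)%N.
  by rewrite truncn_lt_nat // ltr_pdivrMr //; apply: lt_le_trans mM; lra.
exists (Ordinal km) => /=.
by rewrite lerBlDr lerBrDr -ler_pdivlMr // lo -ler_pdivrMr // ltW.
Qed.

(** Coordinate [i0] is left free, the others lie in a grid cell of side [delta]. The conditions on
    [c] do not involve [t]: they empty the cell when [i0] is a bad choice, so that the diameter
    bound holds for every index. *)
Definition slab_cell {N : nat} (c : 'I_N.+1 -> R) (eta delta M : R) (m : nat)
    (i0 : 'I_N.+1) (k : {ffun 'I_N -> 'I_m}) : set {ffun 'I_N.+1 -> R} :=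
  [set t | [/\ `|\sum_i t i * c i| <= eta, forall i, `|c i| <= `|c i0|,
      0 < `|c i0|, eta <= `|c i0| * delta &
      forall j, (k j)%:R * delta - M <= t (lift i0 j) <= (k j).+1%:R * delta - M]].

Lemma geometric_nneseries_fin (a q : R) : 0 <= q < 1 ->
  (\sum_(0 <= n <oo) (a * q ^+ n)%:E < +oo)%E.
Proof.
move=> /andP[q0 q1].
have cv : cvgn (series (geometric a q)).
  by apply/cvg_ex; exists (a / (1 - q)); apply: cvg_geometric_series; rewrite ger0_norm.
rewrite (_ : limn _ = (limn (series (geometric a q)))%:E) ?ltry //.
rewrite -EFin_lim //; congr (limn _); apply/funext => m /=.
by rewrite sumEFin.
Qed.

(** The ambient dimension is [N.+1], so the critical exponent is [N]. The weights of the cells are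
    dominated by a geometric series of ratio [Q * 2 ^ N * x ^ D] with [x = 2^-(s - N) < 1]. *)
Lemma limsup_slabs_null (N B Q : nat) (s : R) (K : nat -> finType)
    (c : forall n, K n -> 'I_N.+1 -> R) :
  N%:R < s -> (forall n, #|K n| <= Q ^ n)%N ->
  exists D : nat, forall A : set {ffun 'I_N.+1 -> R},
    (forall t, A t -> forall n0, exists2 n, (n0 <= n)%N &
      exists k : K n, (exists i, 2 ^- (B * n) < `|c n k i|) /\
                      `|\sum_i t i * c n k i| <= 2 ^- ((B + D) * n)) ->
    hausdorff_measure euclidean_dist s A = 0%E.
Proof.
move=> Ns KQ.
set x : R := 2 `^ (- (s - N%:R)).
have x0 : 0 < x by apply: powR_gt0.
have x1 : x < 1.
  have : 1 `^ (s - N%:R) < 2 `^ (s - N%:R) :> R.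
    by rewrite gt0_ltr_powR ?nnegrE ?subr_gt0 // ltr1n.
  by rewrite /x powRN powR1 invf_lt1 // powR_gt0.
(* [Q] counts slabs, and [2 ^ N] comes from the growth of the cubes. [0 < D] makes the diameters
   tend to 0. *)
have [D [D0 Dq]] : exists D : nat, (0 < D)%N /\ (Q * 2 ^ N)%:R * x ^+ D < 1.
  have e0 : 0 < ((Q * 2 ^ N).+1%:R)^-1 :> R by rewrite invr_gt0 ltr0n.
  have xcvg : (fun D => x ^+ D) @ \oo --> (0 : R) by apply: cvg_expr; rewrite gtr0_norm.
  have [D _ DP] : \forall D \near \oo, (0 < D)%N /\ x ^+ D < ((Q * 2 ^ N).+1%:R)^-1.
    near=> D; split; near: D; first exact: nbhs_infty_gt.
    exact: cvgr_lt xcvg _ e0.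
  exists D; have [D0 xD] := DP D (leqnn D); split => //.
  apply: (@le_lt_trans _ _ ((Q * 2 ^ N).+1%:R * x ^+ D)).
    by rewrite ler_wpM2r ?exprn_ge0 ?ltW // ltr_nat.
  by rewrite mulrC -ltr_pdivlMr ?ltr0n // div1r.
exists D => A Ainf.
pose delta n : R := 2 ^- (D * n).
(* This many intervals of length [delta n] exactly fill [[-2^n, 2^n]]. *)
pose m n := (2 * 2 ^ ((D + 1) * n))%N.
pose C n := [seq slab_cell (c n p.1.1) (2 ^- ((B + D) * n)) (delta n) (2 ^+ n) p.1.2 p.2
  | p <- enum {: K n * 'I_N.+1 * {ffun 'I_N -> 'I_(m n)}}].
have delta0 n : 0 < delta n by rewrite invr_gt0 exprn_gt0.
have mE n : (m n)%:R = 2 * 2 ^+ n / delta n :> R.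
  by rewrite /delta invrK natrM natrX -mulrA -exprD mulnDl mul1n addnC.
apply: (hausdorff_measure_limsup (C := C) (r := fun n => (2 * N + 2)%:R * delta n)).
- exact: euclidean_dist_ge0.
- by apply: le_trans (ltW Ns); rewrite ler0n.
- by move=> n; rewrite mulr_ge0 // ltW.
- rewrite (_ : (fun _ => _) = geometric (2 * N + 2)%:R (2 ^- D)).
    apply: cvg_geometric; rewrite ger0_norm ?invr_ge0 ?exprn_ge0 //.
    by rewrite invf_lt1 ?exprn_gt0 // exprn_egt1 ?ltr1n // -lt0n.
  by apply/funext => n /=; rewrite /delta exprM exprVn.
- move=> n i y z; case: (ltnP i (size (C n))) => [iC|Ci]; last by rewrite nth_default.
  have /mapP[[[k i0] l] _ ->] := mem_nth set0 iC.
  move=> [/= ys cmax c0 etad yl] [zs _ _ _ zl].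
  apply: slab_cell_dist cmax c0 etad ys zs _ => j.
  rewrite ler_distl; move/andP: (yl j) (zl j) => [ylo yhi] /andP[zlo zhi].
  by rewrite -natr1 in yhi zhi; lra.
- pose a : R := N.+1%:R * 2 ^+ N * (2 * N + 2)%:R `^ s.
  apply: le_lt_trans (geometric_nneseries_fin a (q := (Q * 2 ^ N)%:R * x ^+ D) _).
    apply: lee_nneseries => [n _ _|n _]; first by rewrite lee_fin mulr_ge0 ?powR_ge0.
    rewrite lee_fin size_map -cardE !card_prod card_ffun !card_ord.
    rewrite powRM ?ler0n ?(ltW (delta0 n)) // powR_exprV2.
    (* This splits off a factor [delta n ^+ N], which cancels the denominator of [(m n) ^ N]. *)
    have -> : 2 `^ (- s) = 2 ^- N * x.
      rewrite -powR_mulrn // -powRN -powRD; first by congr (_ `^ _); ring.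
      by rewrite pnatr_eq0 implybT.
    rewrite exprMn natrM !natrX mE exprVn -exprM.
    have -> : 2 ^- (N * (D * n)) = delta n ^+ N by rewrite mulnC exprM exprVn.
    have deltaN : delta n ^+ N != 0 by rewrite expf_neq0 ?gt_eqF.
    rewrite (exprM x) !natrM natrX !exprMn exprVn /a (exprAC 2 N n).
    have : 0 <= (2 * N + 2)%:R `^ s :> R by exact: powR_ge0.
    have : 0 <= x ^+ D ^+ n by rewrite !exprn_ge0 // ltW.
    have : 0 <= (2 ^+ n) ^+ N :> R by rewrite !exprn_ge0.
    have : 0 <= 2 ^+ N :> R by rewrite exprn_ge0.
    have : #|K n|%:R <= Q%:R ^+ n :> R by rewrite -natrX ler_nat.
    move: (delta n ^+ N) (_ `^ s) (x ^+ D ^+ n) (2 ^+ N) ((2 ^+ n) ^+ N) deltaN.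
    move=> v w z u u' v0 Kn u0 u'0 z0 w0.
    have -> : #|K n|%:R * N.+1%:R * (u * u' / v) * (w * (v * z)) =
        N.+1%:R * u * w * (#|K n|%:R * u' * z) by field.
    by apply: ler_wpM2l; rewrite ?mulr_ge0 // !ler_wpM2r.
  by rewrite Dq andbT mulr_ge0 // exprn_ge0 // ltW.
move=> t /Ainf tinf n0.
(* Slabs containing [t] occur at arbitrarily high levels; from level [M] on, [t] lies in the growing
   cube. *)
pose M := \max_(i < N.+1) (Num.truncn `|t i|).+1.
have [n nM [k [[i ci] tk]]] := tinf (maxn n0 M).
exists n; first exact: leq_trans (leq_maxl _ _) nM.
have tn j : `|t j| < 2 ^+ n.
  apply: lt_le_trans (truncnS_gt _) _; rewrite -natrX ler_nat.
  apply: (@leq_trans M); first exact: (leq_bigmax (F := fun i => (Num.truncn `|t i|).+1)).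
  by apply: (leq_trans (leq_trans (leq_maxr _ _) nM)); rewrite ltnW // ltn_expl.
have [i0 cmax] : exists i0, forall i, `|c n k i| <= `|c n k i0|.
  by case: (arg_maxP (fun i => `|c n k i|) (erefl : xpredT i)) => j _ jmax;
  exists j => i'; exact: jmax.
have c0 := lt_le_trans ci (cmax i).
have cell j : exists l : 'I_(m n),
    l%:R * delta n - 2 ^+ n <= t (lift i0 j) <= l.+1%:R * delta n - 2 ^+ n.
  have := tn (lift i0 j); rewrite ltr_norml => /andP[lo hi].
  apply: half_open_cell => //; first exact: ltW.
  by rewrite mE divfK ?gt_eqF.
have [l lP] := choice cell.
pose p : K n * 'I_N.+1 * {ffun 'I_N -> 'I_(m n)} := (k, i0, [ffun j => l j]).
exists (index p (enum {: K n * 'I_N.+1 * {ffun 'I_N -> 'I_(m n)}})).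
rewrite (nth_map p) ?index_mem ?mem_enum // nth_index ?mem_enum //; split => //=.
- by apply: le_lt_trans c0; rewrite invr_ge0 exprn_ge0.
(* The slab width is [2^-(B n) * delta n], and [2^-(B n) < |c i0|]. *)
- rewrite mulnDl exprD invfM ler_wpM2r ?(ltW (delta0 _)) //; exact: ltW.
- by move=> j; rewrite ffunE.
Unshelve. all: by end_near. Qed.

End Slabs.

(** * From failure of separation to slabs, and the dimension bound *)

Lemma exists_nat_bound (R : realType) (J : finType) (b : J -> R) :
  exists B : nat, forall j, b j < B%:R.
Proof.
exists (\max_j (Num.truncn (b j)).+1)%N => j.
apply: lt_le_trans (truncnS_gt _) _; rewrite ler_nat.
exact: (leq_bigmax (F := fun i => (Num.truncn (b i)).+1)).
Qed.

Lemma two_powRN_nat (R : realType) (b n : nat) :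
  2 `^ (- (b%:R * n%:R)) = 2 ^- (b * n) :> R.
Proof. by rewrite powRN -natrM powR_mulrn. Qed.

(** By contraposition: without such pairs beyond some level, separation holds for [t] with constant
    [B + D]. [B] only bounds the exponents of the finitely many [S_i], so it is fixed before [t] and
    [D]. *)
Lemma not_cfs_ESC_slabs (R : realType) (N : nat) (n : 'I_N.+1 -> nat)
    (lam : {ffun alphabet n -> R}) :
  (forall i, two_point_ESC i lam) ->
  exists B : nat, forall t, ~ cfs_ESC lam t ->
    forall D n0, exists2 l, (n0 <= l)%N &
      exists p : l.-tuple (alphabet n) * l.-tuple (alphabet n),
      (exists i, 2 ^- (B * l) < `|word_point (two_point_map i lam) p.1 -
                                  word_point (two_point_map i lam) p.2|) /\
      `|\sum_i t i * (word_point (two_point_map i lam) p.1 -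
                      word_point (two_point_map i lam) p.2)| <= 2 ^- ((B + D) * l).
Proof.
move=> /choice[n1 /choice[b esc]].
have [B bB] := exists_nat_bound b; exists B => t nesc D n0.
apply: contrapT => noslab; apply: nesc.
exists (maxn n0 (\max_i n1 i)), (B + D)%:R; split.
  have [b1 _] := esc ord0.
  by apply: lt_le_trans (lt_trans b1 (bB ord0)) _; rewrite ler_nat leq_addr.
move=> l; rewrite geq_max => /andP[n0l n1l] v w vw.
have [|nblk] := pselect (same_block_structure (fun a : alphabet n => tag a) v w); first by left.
right; rewrite two_powRN_nat real_ltNge ?num_real //; apply/negP => le.
apply: noslab; exists l => //; exists (v, w); split => /=; last first.
  under eq_bigr do rewrite mulrBr.
  by rewrite sumrB -!word_point_cfs.
(* If no coefficient is separated, each [S_i] falls into the first alternative of its condition, and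
   the block structures agree for the full grouping. *)
apply: contrapT => nosep; apply: nblk.
apply: same_block_structure_two_groups => [|i]; first by rewrite !size_tuple.
have [_ /(_ l)] := esc i; case/(_ _ v w vw) => // [|sep].
  by apply: leq_trans n1l; exact: leq_bigmax.
exfalso; apply: nosep; exists i; apply: le_lt_trans sep.
by rewrite -two_powRN_nat ler_powR ?ler1n // lerN2 ler_wpM2r // ltW.
Qed.

Unset Implicit Arguments.
Set Strict Implicit.

Theorem proposition4p11 (R : realType) (N : nat) (hN : (2 <= N)%N)
  (n : 'I_N -> nat) (hn : forall i, (1 <= n i)%N)
  (E : 'I_N -> set {ffun alphabet n -> R})
  (hEsub : forall i, E i `<=` open_unit_cube)
  (hEdim : forall i, (dimH (E i) <= ((\sum_(k < N) n k)%N%:R - 1)%:E)%E)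
  (hEesc : forall i lam, (open_unit_cube `\` E i) lam -> two_point_ESC i lam) :
  forall lam, (open_unit_cube `\` \bigcup_i E i) lam ->
    exists F : set {ffun 'I_N -> R},
      (dimH F <= (N%:R - 1)%:E)%E /\
      forall t, (~` F) t -> cfs_ESC lam t.
Proof.
move=> lam [lam01 lamE].
case: N hN n hn E hEsub hEdim hEesc lam lam01 lamE => // N' _ n _ E _ _ esc lam lam01 lamE.
have [|B slabs] := @not_cfs_ESC_slabs R N' n lam.
  by move=> i; apply: esc; split => // Ei; apply: lamE; exists i.
(* [F] is the exceptional set itself; with [N = N'.+1], it suffices to show that it is null for
   every exponent [N' + e] with [e > 0]. *)
exists [set t | ~ cfs_ESC lam t]; split => [|t /contrapT //].
apply/lee_addgt0Pr => e e0.
(* Slabs are indexed by pairs of words, whence the square of the alphabet size. *)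
have [|l|D null] := @limsup_slabs_null R N' B (#|alphabet n| ^ 2) (N'%:R + e)
  (fun l => (l.-tuple (alphabet n) * l.-tuple (alphabet n))%type)
  (fun l p i => word_point (two_point_map i lam) p.1 - word_point (two_point_map i lam) p.2).
- by rewrite ltrDl.
- by rewrite card_prod card_tuple -expnM mulnC expnM mulnn.
apply: ereal_inf_lbound; exists (N'%:R + e); last by rewrite -EFinD -natr1 addrK.
split; first by rewrite addr_ge0 // ltW.
by apply: null => t tn n0; apply: slabs.
Qed.
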